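(* Let $T$ be a tree on $n\geq 2$ vertices. Then the following conditions are equivalent: (i) $T$ is labeling pseudo-Gorenstein*. (ii) If $x_1$ and $x_2$ are leaves of $T$, then $\operatorname{dist}(x_1,x_2)\neq 2$.
   Context: A leaf of a tree is a vertex of degree $1$, and $\operatorname{dist}(x,y)$ is the number of edges on the shortest path between $x$ and $y$. Let $G$ be a finite graph with no loops, no multiple edges and no isolated vertices on the vertex set $\{x_1,\ldots,x_n\}$, $n\geq 2$. Let $S=K[x_1,\ldots,x_n]$ be the polynomial ring over a field $K$, and let the edge ideal $I(G)\subset S$ be the ideal generated by the monomials $x_ix_j$ with $\{x_i,x_j\}$ an edge of $G$. For $\mathfrak{c}=(c_1,\ldots,c_n)\in(\mathbb{Z}_{>0})^n$ and an integer $q\geq 1$, let $(I(G)^q)_{\mathfrak{c}}$ be the ideal of $S$ generated by those monomials $x_1^{a_1}\cdots x_n^{a_n}\in I(G)^q$ with $a_i\leq c_i$ for all $i$. Let $\delta_{\mathfrak{c}}(I(G))$ be the largest integer $q$ with $(I(G)^q)_{\mathfrak{c}}\neq(0)$, and let $\mathcal{B}(G,\mathfrak{c})$ be the minimal set of monomial generators of $(I(G)^{\delta_{\mathfrak{c}}(I(G))})_{\mathfrak{c}}$. Let $\mathcal{D}(G,\mathfrak{c})$ be the set of all $(a_1,\ldots,a_n)\in\mathbb{Z}_{\geq 0}^n$ such that $x_1^{a_1}\cdots x_n^{a_n}$ divides some $u\in\mathcal{B}(G,\mathfrak{c})$, and let $\operatorname{conv}(\mathcal{D}(G,\mathfrak{c}))\subset\mathbb{R}^n$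 be its convex hull. A lattice polytope $\mathcal{P}\subset\mathbb{R}^n$ of dimension $n$ (all vertices in $\mathbb{Z}^n$) is normal if for each $N\geq 2$ every $\mathbf{a}\in N\mathcal{P}\cap\mathbb{Z}^n$ is a sum of $N$ elements of $\mathcal{P}\cap\mathbb{Z}^n$, where $N\mathcal{P}=\{N\mathbf{b}:\mathbf{b}\in\mathcal{P}\}$. (It is known that $\operatorname{conv}(\mathcal{D}(G,\mathfrak{c}))$ is a normal lattice polytope of dimension $n$.) A normal polytope $\mathcal{P}\subset\mathbb{R}^n$ of dimension $n$ is pseudo-Gorenstein* if $|(\mathcal{P}\setminus\partial\mathcal{P})\cap\mathbb{Z}^n|=1$. A finite graph $G$ on $n$ vertices is labeling pseudo-Gorenstein* if there is $\mathfrak{c}\in(\mathbb{Z}_{>0})^n$ for which $\operatorname{conv}(\mathcal{D}(G,\mathfrak{c}))\subset\mathbb{R}^n$ is pseudo-Gorenstein*. *)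

(* Defs.v *)
From HB Require Import structures.
From mathcomp Require Import all_boot all_order all_algebra.
From mathcomp Require Import boolp classical_sets functions cardinality reals.
From mathcomp Require mpoly topology convex.

Set Implicit Arguments.
Unset Strict Implicit.
Unset Printing Implicit Defensive.

Import Order.TTheory GRing.Theory Num.Theory.

Local Open Scope classical_set_scope.
Local Open Scope ring_scope.

(** * Finite simple graphs *)

Record sgraph (n : nat) := SGraph {
  adj :> rel 'I_n;
  adj_sym : symmetric adj;
  adj_irr : irreflexive adj }.

Section Graphs.
Context {n : nat} (G : sgraph n).
Implicit Types x y : 'I_n.

(* [cycle] and [uniq] also accept [[:: x; y]] for an edge [{x, y}], which is
   not a cycle of a simple graph: only lengths at least 3 count. *)
Definition acyclic := forall c : seq 'I_n, cycle G c -> uniq c -> (size c < 3)%N.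

Definition connected := forall x y, connect G x y.

Definition is_tree := connected /\ acyclic.

Definition degree x : nat := #|[set y | G x y]%SET|.

Definition leaf x : Prop := degree x = 1%N.

(* Lengths of (simple) paths are at most [n.-1]; the value is [n] when there is
   no path from [x] to [y]. *)
Definition dist x y : nat :=
  \big[minn/n]_(k < n |
    [exists p : k.-tuple 'I_n,
       [&& path G x p, last x p == y & uniq (x :: p)]]) k.

End Graphs.

(** * Ideals of a commutative ring *)

Section Ideals.
Context {A : comNzRingType}.
Implicit Types I J : set A.

Definition is_ideal I :=
  [/\ I 0, (forall x y, I x -> I y -> I (x + y)) &
      (forall a x, I x -> I (a * x))].

Definition ideal_span (E : set A) : set A := smallest is_ideal E.

Definition ideal_mul I J := ideal_span [set x * y | x in I & y in J].

Definition ideal_exp I (q : nat) := iter q (ideal_mul I) setT.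

End Ideals.

(** * Edge ideals and their bounded powers *)

(* The notations of [mpoly] and of [topology] cannot be imported together; the
   import of [mpoly] is confined to this module. *)
Module EdgeIdeals.
Import mpoly.

Section EdgeIdeals.
Context (K : fieldType) {n : nat}.
Implicit Types (J : set {mpoly K[n]}) (c : 'I_n -> nat) (q : nat).

Definition monomial_ideal (E : set 'X_{1..n}) : set {mpoly K[n]} :=
  ideal_span [set 'X_[K, m] | m in E].

(* The ideal generated by the monomials of [J] whose exponent is at most [c]. *)
Definition bounded_part c J : set {mpoly K[n]} :=
  monomial_ideal [set m | J 'X_[K, m] /\ forall i, (m i <= c i)%N].

(* [xget] picks the unique such set when [J] is a monomial ideal. *)
Definition minimal_generators J : set 'X_{1..n} :=
  xget set0 [set B | monomial_ideal B = J /\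
    forall B' : set 'X_{1..n}, B' `<=` B -> monomial_ideal B' = J -> B' = B].

Variable G : sgraph n.

Definition edge_ideal : set {mpoly K[n]} :=
  ideal_span [set p | exists i j, G i j /\ p = 'X_i * 'X_j].

Definition bounded_power c q := bounded_part c (ideal_exp edge_ideal q).

(* If [G] has an edge, this is the largest [q >= 1] with [bounded_power c q]
   nonzero; if it has none, no [q >= 1] qualifies and the value is [0]. *)
Definition delta c : nat :=
  let nonzero q := (0 < q)%N /\ bounded_power c q <> [set 0] in
  xget 0%N [set q | nonzero q /\ forall r, nonzero r -> (r <= q)%N].

Definition Bset c : set 'X_{1..n} := minimal_generators (bounded_power c (delta c)).

(* [(a <= u)%MM] is the componentwise order, i.e. ['X_[a]] divides ['X_[u]]. *)
Definition Dset c : set 'X_{1..n} := [set a | exists2 u, Bset c u & (a <= u)%MM].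

Definition Dpoints (R : realType) c : set 'rV[R]_n :=
  [set \row_i (a i)%:R | a in Dset c].

End EdgeIdeals.
End EdgeIdeals.
Export EdgeIdeals.

(** * Lattice polytopes *)

Module Polytopes.
Import topology convex.
Import numFieldTopology.Exports.

Section Polytopes.
Context {R : realType} {n : nat}.
Implicit Types P E : set 'rV[R]_n.

Definition conv E : set 'rV[R]_n := smallest (@convex_set R 'rV[R]_n) E.

Definition affine_hull E : set 'rV[R]_n :=
  [set x | exists (k : nat) (p : 'I_k -> 'rV[R]_n) (t : 'I_k -> R),
     [/\ forall i, E (p i), \sum_i t i = 1 & x = \sum_i t i *: p i]].

Definition polytope P := exists2 E, finite_set E & P = conv E.

Definition vertex P (v : 'rV[R]_n) :=
  P v /\ forall (y z : 'rV[R]_n) (t : R), P y -> P z -> 0 < t < 1 ->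
    v = t *: y + (1 - t) *: z -> y = v /\ z = v.

Definition lattice : set 'rV[R]_n := [set x | forall i, x ord0 i \is a Num.int].

Definition lattice_polytope P := polytope P /\ vertex P `<=` lattice.

(* dimension [n], i.e. the affine hull is the whole of [R^n] *)
Definition full_dimensional P := affine_hull P = setT.

Definition dilate (N : nat) P : set 'rV[R]_n := [set N%:R *: b | b in P].

Definition normal_polytope P :=
  [/\ lattice_polytope P, full_dimensional P &
      forall N : nat, (2 <= N)%N ->
      forall a, (dilate N P `&` lattice) a ->
      exists2 f : 'I_N -> 'rV[R]_n,
        (forall k, (P `&` lattice) (f k)) & a = \sum_k f k].

Definition boundary P : set 'rV[R]_n := closure P `\` interior P.

Definition pseudo_gorenstein_star P :=
  normal_polytope P /\ ((P `\` boundary P) `&` lattice #= `I_1)%card.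

End Polytopes.
End Polytopes.
Export Polytopes.

Definition labeling_pseudo_gorenstein_star
    (R : realType) (K : fieldType) (n : nat) (G : sgraph n) :=
  exists c : 'I_n -> nat, (forall i, (0 < c i)%N) /\
    pseudo_gorenstein_star (conv (Dpoints K G c : set 'rV[R]_n)).

(* Main.v *)
Require Import Defs.
From HB Require Import structures.
From mathcomp Require Import all_boot all_order all_algebra.
From mathcomp Require Import boolp classical_sets functions cardinality.
From mathcomp Require Import reals interval_inference.
From mathcomp Require mpoly topology convex.
From mathcomp Require Import zify lra.

Set Implicit Arguments.
Unset Strict Implicit.
Unset Printing Implicit Defensive.

Import Order.TTheory GRing.Theory Num.Theory.

(** Write a c-matching as a symmetric weight w on the edges with natural values
    and deg w <= c at each vertex.  The lattice points in question are exactly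
    the vectors a with a <= deg w <= c for some w.  One inclusion is the algebra
    of edge monomials; the other needs every c-matching to be dominated, vertex
    by vertex, by one of maximum size ([weighting_exchange], [in_Dset]).  In
    particular the convex hull P of these points is closed under decreasing
    coordinates, so a lattice point is interior as soon as all its coordinates
    are positive and some point of P is strictly larger in each coordinate.

    If two leaves x1, x2 share their neighbour y, then
    deg w x1 + deg w x2 <= deg w y for every w.  Hence replacing the coordinate
    at y by the sum of the coordinates at x1 and x2 maps P into itself, and an
    interior lattice point p yields two: one with p x1 + p x2 >= 2 at y and one
    with 1 at y ([twin_leaves_interior]).  So P never has exactly one.

    If no two leaves share a neighbour, the constant labelling c = 2 works.  All
    points of P have coordinates at most 2, so an interior lattice point must be
    (1, ..., 1).  It is interior because for each vertex v there is a 2-matching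
    with all degrees 1 or 2 and degree 2 at v ([path_cover]): the mean of these
    degree vectors over v exceeds 1 everywhere.

    Normality of P rests on a rounding property of forests: a real edge weight
    can be replaced by an integral one such that every edge weight and every
    degree moves by less than 1 ([forest_rounding]).  Rounding the weight behind
    a lattice point of N P gives an integral weight w with deg w <= N c, and
    rounding w / N splits off one c-matching while leaving degrees at most
    (N - 1) c ([weighting_peel]). *)

Local Open Scope nat_scope.

(** * Edge weights and their degrees *)

Section Weightings.
Context {n : nat} (G : sgraph n).
Implicit Types (w : 'I_n -> 'I_n -> nat) (i j k : 'I_n) (c u : 'I_n -> nat).

Definition weighting w :=
  (forall i j, w i j = w j i) /\ (forall i j, 0 < w i j -> G i j).

Definition wdeg w i := \sum_j w i j.

Definition edge_weight i j : 'I_n -> 'I_n -> nat :=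
  fun a b => ((a == i) && (b == j)) || ((a == j) && (b == i)).

Lemma adj_neq i j : G i j -> i != j.
Proof. by move=> Gij; apply/eqP => eij; rewrite eij adj_irr in Gij. Qed.

Lemma edge_weighting i j : G i j -> weighting (edge_weight i j).
Proof.
move=> Gij; split=> a b; rewrite /edge_weight.
  by rewrite orbC ![(b == _) && _]andbC.
by rewrite lt0b => /orP[] /andP[/eqP-> /eqP->] //; rewrite adj_sym.
Qed.

Lemma edge_weightP (P : 'I_n -> 'I_n -> Prop) i j a b :
  P i j -> P j i -> 0 < edge_weight i j a b -> P a b.
Proof. by move=> Pij Pji; rewrite /edge_weight lt0b => /orP[] /andP[/eqP-> /eqP->]. Qed.

Lemma edge_weight_le1 i j a b : edge_weight i j a b <= 1.
Proof. exact: leq_b1. Qed.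

Lemma wdeg_edge i j a : i != j -> wdeg (edge_weight i j) a = (a == i) + (a == j).
Proof.
move=> nij; rewrite /wdeg /edge_weight.
under eq_bigr => b _.
  have -> : ((a == i) && (b == j) || (a == j) && (b == i) : nat)
          = (if b == j then (a == i : nat) else 0) + (if b == i then (a == j : nat) else 0).
    have : ~~ ((a == i) && (a == j)).
      by apply: contra nij => /andP[/eqP <- /eqP <-].
    by case: (a == i); case: (a == j); case: (b == j); case: (b == i).
  over.
by rewrite big_split /= -!big_mkcond /= !big_pred1_eq.
Qed.

Lemma ltn_sum_strict (I : finType) (F1 F2 : I -> nat) x :
  (forall y, F1 y <= F2 y) -> F1 x < F2 x -> \sum_y F1 y < \sum_y F2 y.
Proof.
move=> le lt; rewrite (bigD1 x) //= [ltnRHS](bigD1 x) //= -addSn.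
by rewrite leq_add // leq_sum.
Qed.

Lemma sum_ltn_exists (I : finType) (F1 F2 : I -> nat) :
  \sum_y F1 y < \sum_y F2 y -> exists y, F1 y < F2 y.
Proof.
move=> lt; apply/existsP/contraT; rewrite negb_exists => /forallP h.
by move: lt; rewrite ltnNge leq_sum // => y _; rewrite leqNgt h.
Qed.

Definition wdist w1 w2 := \sum_i \sum_j ((w1 i j - w2 i j) + (w2 i j - w1 i j)).

Lemma wdist_lt w1 w2 w i j :
  (forall a b, (w1 a b - w a b) + (w a b - w1 a b)
            <= (w2 a b - w a b) + (w a b - w2 a b)) ->
  (w1 i j - w i j) + (w i j - w1 i j) < (w2 i j - w i j) + (w i j - w2 i j) ->
  wdist w1 w < wdist w2 w.
Proof.
move=> le lt; apply: (@ltn_sum_strict _ _ _ i) => [a|]; first exact: leq_sum.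
exact: (@ltn_sum_strict _ _ _ j).
Qed.

(** Among the c-matchings of size at least that of [ws], take one closest to [w].
    If its degree at some [i] is too small, some edge [ij] carries less than in [w];
    adding [ij], and dropping an edge [jk] that carries more than in [w] when [j]
    is saturated, comes closer to [w] without losing size.  Hence every
    c-matching is dominated in degrees by one of maximum size. *)
Lemma weighting_exchange c w ws :
    weighting w -> (forall i, wdeg w i <= c i) ->
    weighting ws -> (forall i, wdeg ws i <= c i) ->
  exists w', [/\ weighting w', (forall i, wdeg w i <= wdeg w' i <= c i) &
    \sum_i wdeg ws i <= \sum_i wdeg w' i].
Proof.
move=> Ww wc; have [m] := ubnP (wdist ws w).
elim: m ws => // m IH ws; rewrite ltnS => dm Ws sc.
have [h|] := pselect (forall i, wdeg w i <= wdeg ws i).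
  by exists ws; split=> // i; rewrite h sc.
move=> /existsNP[i /negP]; rewrite -ltnNge => lti.
have [j ltij] := sum_ltn_exists lti.
have Gij : G i j by apply: Ww.2; apply: leq_ltn_trans ltij.
have nij := adj_neq Gij.
have ltE a b : 0 < edge_weight i j a b -> ws a b < w a b.
  by apply: (edge_weightP (P := fun a b => ws a b < w a b)); rewrite // (Ww.1 j) (Ws.1 j).
have [slack|full] := ltnP (wdeg ws j) (c j).
  (* There is room at j: the edge ij can be added. *)
  pose w1 a b := ws a b + edge_weight i j a b.
  have d1 a : wdeg w1 a = wdeg ws a + ((a == i) + (a == j)).
    by rewrite -wdeg_edge // /wdeg -big_split.
  have W1 : weighting w1.
    split=> a b; first by rewrite /w1 (Ws.1 a b) ((edge_weighting Gij).1 a b).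
    rewrite addn_gt0 => /orP[]; first exact: Ws.2.
    exact: (edge_weighting Gij).2.
  have [|a|w' [W' h' s']] := IH w1 _ W1.
  - apply: leq_trans dm; apply: (@wdist_lt _ _ _ i j) => [a b|]; rewrite /w1.
      by have := ltE a b; have := edge_weight_le1 i j a b; lia.
    by rewrite /edge_weight !eqxx /=; lia.
  - rewrite d1; case: eqVneq => [->|_]; first by rewrite (negbTE nij) addn0 addn1 (leq_trans lti).
    by case: eqVneq => [->|_]; rewrite ?addn1 // ?addn0.
  exists w'; split=> //; apply: leq_trans s'.
  by apply: leq_sum => a _; rewrite d1 leq_addr.
(* The vertex j is saturated, so it carries somewhere more than w does. *)
have [k ltjk] : exists k, (w j k < ws j k).
  have : \sum_b w j b < \sum_b (ws j b + (b == i)).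
    rewrite big_split /= -big_mkcond /= big_pred1_eq addn1 ltnS.
    by apply: leq_trans full; apply: wc.
  case/sum_ltn_exists=> k; case: eqVneq => [->|_]; last by rewrite addn0; exists k.
  by rewrite addn1 ltnS leqNgt (Ww.1 j) (Ws.1 j) ltij.
have nki : k != i.
  by apply/eqP => eki; rewrite eki (Ww.1 j) (Ws.1 j) ltnNge (ltnW ltij) in ltjk.
have Gjk : G j k by apply: Ws.2; apply: leq_ltn_trans ltjk.
have njk := adj_neq Gjk.
pose w1 a b := ws a b + edge_weight i j a b - edge_weight j k a b.
have gtE a b : 0 < edge_weight j k a b -> w a b < ws a b.
  by apply: (edge_weightP (P := fun a b => w a b < ws a b)); rewrite // (Ww.1 k) (Ws.1 k).
have le1 a b : edge_weight j k a b <= ws a b.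
  by have := gtE a b; have := edge_weight_le1 j k a b; lia.
have d1 a : wdeg w1 a + ((a == j) + (a == k)) = wdeg ws a + ((a == i) + (a == j)).
  rewrite -!wdeg_edge // /wdeg -!big_split /=; apply: eq_bigr => b _.
  by rewrite /w1 subnK // (leq_trans (le1 _ _)) ?leq_addr.
have {}d1 a : wdeg w1 a + (a == k) = wdeg ws a + (a == i) by have := d1 a; lia.
have W1 : weighting w1.
  split=> a b.
    by rewrite /w1 (Ws.1 a b) ((edge_weighting Gij).1 a b) ((edge_weighting Gjk).1 a b).
  rewrite subn_gt0 => /(leq_ltn_trans (leq0n _)); rewrite addn_gt0 => /orP[]; first exact: Ws.2.
  exact: (edge_weighting Gij).2.
have [|a|w' [W' h' s']] := IH w1 _ W1.
- apply: leq_trans dm; apply: (@wdist_lt _ _ _ i j) => [a b|]; rewrite /w1.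
    have := edge_weight_le1 i j a b; have := edge_weight_le1 j k a b.
    by have := ltE a b; have := gtE a b; lia.
  rewrite /edge_weight !eqxx (negbTE nij) (eq_sym i k) (negbTE nki) /=; lia.
- have := d1 a; have := sc a; case: (eqVneq a i) => [->|_]; last by lia.
  by have := wc i; lia.
exists w'; split=> //; apply: leq_trans s'.
have sum1 x : \sum_(a < n) (a == x : nat) = 1.
  by rewrite -big_mkcond /= big_pred1_eq.
rewrite -(leq_add2r 1) -{1}(sum1 i) -(sum1 k) -!big_split /=.
by apply: leq_sum => a _; rewrite d1.
Qed.

End Weightings.

(** * Levels in a tree *)

Section Levelling.
Context {n : nat} (G : sgraph n).

(** For the distance [d] to a root this says that the parent of [y] is its only
    neighbour that is not farther from the root.  The rounding argument sees a
    forest only through this property. *)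
Definition levelling (d : 'I_n -> nat) := forall y x x',
  G y x -> G y x' -> d x <= d y -> d x' <= d y -> x = x'.

(** The level is the length of a shortest walk from [v].  Two neighbours of [y]
    at most as far from [v] as [y] are both joined to [v] by walks avoiding [y],
    hence to each other, which would close a cycle through [y]. *)
Lemma tree_levelling v : is_tree G ->
  exists d, [/\ levelling d, d v = 0 & forall x, x != v -> 0 < d x].
Proof.
move=> [conn acyc].
pose walk x k := [exists p : k.-tuple 'I_n, path G v p && (last v p == x)].
have ex x : exists k, walk x k.
  have /connectP[p pp ->] := conn v x.
  by exists (size p); apply/existsP; exists (in_tuple p); rewrite pp eqxx.
pose d x := ex_minn (ex x).
have d0 x : d x = 0 -> x = v.
  rewrite /d; case: ex_minnP => k /existsP[p /andP[_ /eqP pl]] _ k0.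
  by move: p pl; rewrite k0 => p; rewrite tuple0.
have dS x k : d x = k.+1 -> exists2 z, G z x & d z <= k.
  rewrite {1}/d; case: ex_minnP => l /existsP[p /andP[pp /eqP pl]] _ lk.
  move: p pp pl; rewrite {l}lk => p; case/tupleP: p => a p.
  rewrite [tval _]/=; case/lastP: (tval p) (size_tuple p) => [|q z].
    move=> /= k0; rewrite andbT => va <-; exists v => //.
    rewrite /d; case: ex_minnP => l _ -> //; apply/existsP.
    by rewrite -k0; exists [tuple] => /=.
  rewrite size_rcons => sq; rewrite -rcons_cons rcons_path last_rcons => /andP[pq Gz <-].
  exists (last v (a :: q)) => //; rewrite {1}/d; case: ex_minnP => l _; apply.
  apply/existsP; rewrite -sq; exists (in_tuple (a :: q)).
  by rewrite pq eqxx.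
exists d; split; last 2 first.
- by rewrite /d; case: ex_minnP => l _ h; apply/eqP; rewrite -leqn0; apply: h;
    apply/existsP; exists [tuple]; rewrite /= eqxx.
- by move=> x; rewrite lt0n; apply: contraNneq => /d0->.
move=> y x x' Gyx Gyx' dx dx'.
(* Walks avoiding y. *)
pose e := [rel a b | [&& G a b, a != y & b != y]].
have e_sym : symmetric e.
  by move=> a b; rewrite /= adj_sym [(a != y) && _]andbC.
have to_v z : d z <= d y -> z != y -> connect e z v.
  have [m] := ubnP (d z); elim: m z => // m IH z; rewrite ltnS => dm dz zy.
  case dz0 : (d z) => [|k]; first by rewrite (d0 z).
  have [t Gtz dt] := dS _ _ dz0.
  have dty : d t < d y by apply: leq_trans dz; rewrite dz0 ltnS.
  have ty : t != y by apply: contraTneq dty => ->; rewrite ltnn.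
  apply: (@connect_trans _ _ t).
    by apply: connect1; rewrite /= adj_sym Gtz zy ty.
  by apply: IH => //; [rewrite (leq_trans _ dm) // dz0 | rewrite ltnW].
have xy : x != y by rewrite eq_sym; apply: adj_neq Gyx.
have xy' : x' != y by rewrite eq_sym; apply: adj_neq Gyx'.
have : connect e x x'.
  apply: (connect_trans (to_v _ dx xy)).
  by rewrite (sym_connect_sym e_sym) to_v.
case/connectP=> p0 pp0; case/shortenP: pp0 => p pp up _.
case: p pp up => [//|z p] pp up /= lp.
suff /acyc : cycle G [:: y, x, z & p].
  move=> h; suff /h : uniq [:: y, x, z & p] by [].
  have Hy : y \notin [:: x, z & p].
    rewrite in_cons eq_sym (negbTE xy) /=.
    have : forall a q, path e a q -> y \notin q.
      move=> a q; elim: q a => // b q IHq a /= /andP[/and3P[_ _ yb] /IHq h'].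
      by rewrite in_cons eq_sym (negbTE yb).
    by apply; apply: pp.
  by rewrite /= Hy /= -/(uniq (z :: p)); exact: up.
have sube a b : e a b -> G a b by case/and3P.
rewrite /cycle rcons_path [last _ _]/= -lp [G _ y]adj_sym Gyx' andbT.
by rewrite [path _ _ _]/= Gyx; exact: (sub_path sube pp).
Qed.

End Levelling.

(** * Rounding edge weights on a forest *)

Section Rounding.
Local Open Scope ring_scope.
Context {n : nat} (G : sgraph n) (R : archiRealFieldType).
Implicit Types (W : 'I_n -> 'I_n -> R) (w : 'I_n -> 'I_n -> int).

(** Any integer z with m <= z < m + 1 will do, where m is the smaller of the two reals. *)
Lemma int_near (s t : R) : `|s - t| < 1 ->
  exists z : int, `|z%:~R - s| < 1 /\ `|z%:~R - t| < 1.
Proof.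
move=> st; exists (Num.ceil (Num.min s t)).
have := ceil_ge (Num.min s t); have := gt_pred_ceil (Num.min s t).
move: st; rewrite intrB !ltr_norml minEle; case: ifP => [h|/negbT]; last rewrite -ltNge => h.
all: move=> /andP[h1 h2] h3 h4; split; apply/andP; split; lra.
Qed.

Lemma int_eq (a : int) (x : R) : x \is a Num.int -> `|a%:~R - x| < 1 -> a%:~R = x.
Proof.
move=> /intrP[m ->]; rewrite -intrB -intr_norm ltrz1 => h.
by congr intr; move: h; lia.
Qed.

(** Moving by less than 1 means becoming a floor or a ceiling, and fixes integers.
    The edges of non-integral weight form a forest; a vertex [x] of maximal level
    on it lies on a single such edge [xy].  The remaining edges are rounded by
    induction, and the weight of [xy] is then rounded so as to suit both itself
    and the degree of [y]; the degree of [x] follows because the other weights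
    at [x] are integers. *)
Lemma forest_rounding d W : levelling G d ->
    (forall i j, W i j = W j i) -> (forall i j, W i j != 0 -> G i j) ->
  exists w, [/\ forall i j, w i j = w j i,
    forall i j, `|(w i j)%:~R - W i j| < 1 &
    forall i, `|(\sum_j w i j)%:~R - \sum_j W i j| < 1].
Proof.
move=> lev; pose frac W := [set ij : 'I_n * 'I_n | W ij.1 ij.2 \isn't a Num.int]%SET.
have [m] := ubnP #|frac W|; elim: m W => // m IH W; rewrite ltnS => fm symW suppW.
have [/existsP[x0 /existsP[y0 nint0]]|] :=
  boolP [exists x, [exists y, W x y \isn't a Num.int]]; last first.
  move=> /existsPn intW0; have {intW0}intW i j : W i j \is a Num.int.
    by have /existsPn/(_ j) := intW0 i; rewrite negbK.
  exists (fun i j => Num.floor (W i j)); split.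
  - by move=> i j; rewrite symW.
  - by move=> i j; rewrite floorK // subrr normr0.
  - move=> i; rewrite raddf_sum /= -sumrB big1 ?normr0 // => j _.
    by rewrite floorK // subrr.
pose P x := [exists y, W x y \isn't a Num.int].
have Px0 : P x0 by apply/existsP; exists y0.
case: (arg_maxnP d Px0) => x /existsP[y nint] xmax.
have Gxy : G x y.
  by apply: suppW; apply: contraNneq nint => ->; rewrite rpred0.
have nxy := adj_neq Gxy.
have intx j : j != y -> W x j \is a Num.int.
  move=> jy; apply: contraNT jy => nj; apply/eqP; apply: (lev x) => //.
  - by apply: suppW; apply: contraNneq nj => ->; rewrite rpred0.
  - by apply: xmax; apply/existsP; exists x; rewrite symW.
  - by apply: xmax; apply/existsP; exists x; rewrite symW.
pose here i j := ((i == x) && (j == y)) || ((i == y) && (j == x)).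
have hereC i j : here i j = here j i.
  by rewrite /here orbC ![(j == _) && _]andbC.
pose W0 i j := if here i j then 0 else W i j.
have [||i j|w0 [sym0 near0 deg0]] := IH W0.
- apply: leq_trans fm; apply: proper_card; apply/properP; split.
    apply/fintype.subsetP=> -[i j]; rewrite !inE /W0 /=; case: ifP => // _.
    by rewrite rpred0.
  by exists (x, y); rewrite !inE //= /W0 /here !eqxx rpred0.
- by move=> i j; rewrite /W0 hereC symW.
- by rewrite /W0; case: ifP => [_|_ /suppW]; rewrite ?eqxx.
have w00 : w0 x y = 0.
  have := near0 x y; rewrite /W0 /here !eqxx subr0 -intr_norm ltrz1.
  by move: (w0 x y) => z; lia.
have w00' : w0 y x = 0 by rewrite sym0.
have sum_here (V : zmodType) (a : V) i :
    \sum_j (if here i j then a else 0) = if (i == x) || (i == y) then a else 0.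
  rewrite -big_mkcond /here; case: (eqVneq i x) => [->|_] /=.
    by rewrite (negbTE nxy) (big_pred1 y) // => j /=; rewrite orbF.
  by case: (i == y) => /=; rewrite ?big_pred1_eq ?big_pred0_eq.
have WE i j : W i j = W0 i j + if here i j then W x y else 0.
  rewrite /W0; case: ifP; rewrite ?addr0 // add0r /here => /orP[] /andP[/eqP-> /eqP->] //.
have near_y := deg0 y.
pose r := \sum_j W0 y j; pose r' := (\sum_j w0 y j)%:~R : R.
(* The new weight has to be near W x y, and near what is missing for the degree of y. *)
have [|z [zs zt]] := @int_near (r + W x y - r') (W x y).
  by rewrite addrAC addrK distrC; exact: near_y.
pose w i j := w0 i j + if here i j then z else 0.
exists w; split=> [i j|i j|i].
- by rewrite /w sym0 hereC.
- rewrite /w WE intrD; case: ifP; last by rewrite !addr0 => _; exact: near0.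
  move=> h; rewrite /W0 h add0r (_ : w0 i j = 0) ?add0r //.
  by move: h => /orP[] /andP[/eqP-> /eqP->].
- rewrite (eq_bigr _ (fun j _ => WE i j)) /w !big_split /= !sum_here.
  have [->|_] := eqVneq i x.
    rewrite /= intrD (_ : (\sum_j w0 x j)%:~R = \sum_j W0 x j).
      by rewrite opprD addrACA subrr add0r.
    rewrite raddf_sum /=; apply: eq_bigr => j _; apply: int_eq (near0 x j).
    rewrite /W0; case: ifP; rewrite ?rpred0 // /here eqxx (negbTE nxy) orbF => /negbT.
    exact: intx.
  have [->|_] := eqVneq i y; last by rewrite /= !addr0; exact: deg0.
  by move: zs; rewrite opprB addrA [_ + r']addrC /= intrD.
Qed.

End Rounding.

(** * Splitting a weight into c-matchings *)

Section IntegerDecomposition.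
Context {n : nat} (G : sgraph n).
Implicit Types (w : 'I_n -> 'I_n -> nat) (c a : 'I_n -> nat).

Lemma forest_rounding_nat (R : archiRealFieldType) d (W : 'I_n -> 'I_n -> R) :
    levelling G d -> (forall i j, W i j = W j i) ->
    (forall i j, 0 <= W i j)%R -> (forall i j, W i j != 0%R -> G i j) ->
  exists w, [/\ weighting G w, (forall i j, `|(w i j)%:R - W i j| < 1)%R &
    (forall i, `|(wdeg w i)%:R - \sum_j W i j| < 1)%R].
Proof.
move=> lev symW W0 suppW.
have [w [symw near degw]] := forest_rounding lev symW suppW.
have w0 i j : (0 <= w i j)%R.
  have : ((-1)%:~R < (w i j)%:~R :> R)%R.
    have := near i j; have := W0 i j; rewrite ltr_norml => ? /andP[? ?].
    by rewrite mulrN1z; lra.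
  by rewrite ltr_int; move: (w i j) => z; lia.
have natw i j : ((`|w i j|%N)%:R = (w i j)%:~R :> R)%R.
  by rewrite natr_absz ger0_norm.
exists (fun i j => `|w i j|%N); split.
- split=> [i j|i j]; first by rewrite symw.
  rewrite lt0n absz_eq0 => nz; apply: suppW; apply: contraNneq nz => W00.
  have := near i j; rewrite W00 subr0 -intr_norm ltrz1.
  by move: (w i j) => z; lia.
- by move=> i j; rewrite natw.
- move=> i; rewrite /wdeg natr_sum; under eq_bigr do rewrite natw.
  by rewrite -raddf_sum /=; exact: degw.
Qed.

(** The summand [w1] is a rounding of [w / N.+1]: its degrees are less than
    [c + 1], and more than [wdeg w / N.+1 - 1], which leaves degrees at most
    [N * c]. *)
Lemma weighting_peel d c N w : levelling G d ->
    weighting G w -> (forall i, wdeg w i <= N.+1 * c i) ->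
  exists w1, [/\ weighting G w1, (forall i j, w1 i j <= w i j),
    (forall i, wdeg w1 i <= c i) & (forall i, wdeg w i <= wdeg w1 i + N * c i)].
Proof.
move=> lev Ww wc; pose W i j : rat := ((w i j)%:R / N.+1%:R)%R.
have N0 : (0 < N.+1%:R :> rat)%R by rewrite ltr0n.
have symW i j : W i j = W j i by rewrite /W Ww.1.
have [|i j|w1 [W1 near near_deg]] := forest_rounding_nat lev symW.
- by move=> i j; rewrite divr_ge0.
- move=> nz; apply: Ww.2; rewrite lt0n; apply: contraNneq nz => /eqP w0.
  by rewrite /W (eqP w0) mul0r.
have {}near_deg i : (`|(wdeg w1 i)%:R - (wdeg w i)%:R / N.+1%:R| < 1 :> rat)%R.
  by have := near_deg i; rewrite /W -mulr_suml -natr_sum.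
have scale (x y : nat) : (`|x%:R - y%:R / N.+1%:R| < 1 :> rat)%R ->
    (x * N.+1 < y + N.+1) /\ (y < x * N.+1 + N.+1).
  rewrite ltr_norml => /andP[]; rewrite -(ltr_pM2r N0) => h1; rewrite -(ltr_pM2r N0).
  move: h1; rewrite !mulrBl divfK ?gt_eqF // => h1 h2.
  by rewrite -!(ltr_nat rat) !natrD !natrM; split; lra.
exists w1; split=> // [i j|i|i].
- have [h _] := scale _ _ (near i j); nia.
- have [h _] := scale _ _ (near_deg i); have := wc i; nia.
- have [_ h] := scale _ _ (near_deg i); have := wc i; nia.
Qed.

Definition coverable c a :=
  exists2 w, weighting G w & forall i, a i <= wdeg w i <= c i.

Lemma coverable_decomposition d c N w a : levelling G d ->
    weighting G w -> (forall i, a i <= wdeg w i <= N * c i) ->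
  exists2 f : 'I_N -> 'I_n -> nat, forall k, coverable c (f k) &
    forall i, a i = \sum_k f k i.
Proof.
move=> lev; elim: N w a => [|N IH] w a Ww h.
  exists (fun _ _ => 0); first by case.
  move=> i; rewrite big_ord0; apply/eqP; rewrite -leqn0.
  by have /andP[h1 h2] := h i; apply: leq_trans h1 h2.
have [i|w1 [W1 le1 deg1 rest]] := @weighting_peel d c N w lev Ww.
  by case/andP: (h i).
have wdegB i : wdeg (fun i j => w i j - w1 i j) i = wdeg w i - wdeg w1 i.
  by rewrite /wdeg sumnB.
have [|i|f fc fa] := IH (fun i j => w i j - w1 i j) (fun i => a i - minn (a i) (wdeg w1 i)).
- split=> i j; first by rewrite Ww.1 W1.1.
  by rewrite subn_gt0 => /(leq_ltn_trans (leq0n _)); exact: Ww.2.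
- rewrite wdegB; have := h i; have := rest i; rewrite mulSn; lia.
exists (fun k i => if unlift ord0 k is Some k' then f k' i else minn (a i) (wdeg w1 i)).
  move=> k; case: (unlift ord0 k) => [k'|]; first exact: fc.
  by exists w1 => // i; rewrite geq_minr deg1.
move=> i; rewrite big_ord_recl unlift_none.
under eq_bigr do rewrite liftK.
by rewrite -fa subnKC // geq_minl.
Qed.

End IntegerDecomposition.

(** * 2-matchings covering a tree *)

Section PathCover.
Context {n : nat} (G : sgraph n).

Definition no_twin_leaves :=
  forall x1 x2 y, leaf G x1 -> leaf G x2 -> G x1 y -> G x2 y -> x1 = x2.

Lemma leafP x : leaf G x -> exists s, forall y, G x y = (y == s).
Proof.
move=> /eqP/cards1P[s hs]; exists s => y.
by move/setP: hs => /(_ y); rewrite !inE.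
Qed.

Lemma sum_bool_le1 (I : finType) (P : pred I) :
  (forall x y, P x -> P y -> x = y) -> \sum_x P x <= 1.
Proof.
move=> uniqP; have [[x Px]|no] := pselect (exists x, P x).
  rewrite (bigD1 x) //= Px big1 // => y yx; case Py : (P y) => //.
  by rewrite (uniqP x y) ?eqxx in yx.
by rewrite big1 // => x _; case Px : (P x) => //; case: no; exists x.
Qed.

Lemma no_isolated : 1 < n -> connected G -> forall x, exists y, G x y.
Proof.
move=> n1 conn x; have [y yx] : exists y : 'I_n, y != x.
  have : 0 < #|predC1 x| by rewrite cardC1 card_ord; case: (n) n1 => [|[]].
  by move=> /card_gt0P[y]; rewrite inE; exists y.
have /connectP[[|z p] /=] := conn x y; first by move=> _ e; rewrite e eqxx in yx.
by case/andP=> Gxz _ _; exists z.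
Qed.

(** Root the tree at [v].  A vertex that is neither a leaf nor next to one (call it
    inner) sends weight 1 to one of its children, or to two of them if it is
    [v]; such a child exists since the vertex has a second neighbour besides its
    parent.  As parents are unique, a vertex receives at most 1.  The pendant
    edge at the neighbour [s] of a leaf then gets 2 minus the weight received by
    [s], which makes the degree of [s] equal to 2. *)
Lemma path_cover v : 1 < n -> is_tree G -> no_twin_leaves ->
  exists2 w, weighting G w & (forall i, 1 <= wdeg w i <= 2) /\ wdeg w v = 2.
Proof.
move=> n1 tree twin.
have [d [lev dv0 dpos]] := tree_levelling v tree.
have nbr := no_isolated n1 tree.1.
have twonbr x : ~ leaf G x -> exists y1 y2, [/\ G x y1, G x y2 & y1 != y2].
  move=> nl; have [y1 G1] := nbr x.
  have [/existsP[y2 /andP[G2 y12]]|/existsPn no] :=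
    boolP [exists y2, G x y2 && (y1 != y2)]; first by exists y1, y2.
  case: nl; rewrite /leaf /degree; apply/eqP/cards1P; exists y1; apply/setP => y.
  rewrite !inE; apply/idP/eqP => [Gy|->//]; apply/eqP; move: (no y).
  by rewrite Gy negbK eq_sym.
pose lf x := degree G x == 1.
pose inner x := ~~ lf x && [forall y, G x y ==> ~~ lf y].
pose f1 x := odflt x [pick y | G x y && (d x < d y)].
pose f2 := odflt v [pick y | G v y && (y != f1 v)].
have f1P x : inner x -> G x (f1 x) /\ d x < d (f1 x).
  case/andP=> /eqP nl _; rewrite /f1; case: pickP => [y /andP[//]|no].
  have [y1 [y2 [G1 G2]]] := twonbr _ nl; case/eqP; apply: (lev x) => //.
    by rewrite leqNgt; have := no y1; rewrite G1 /= => ->.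
  by rewrite leqNgt; have := no y2; rewrite G2 /= => ->.
have f2P : inner v -> G v f2 /\ f2 != f1 v.
  case/andP=> /eqP nl _; rewrite /f2; case: pickP => [y /andP[//]|no].
  have [y1 [y2 [G1 G2 /eqP[]]]] := twonbr _ nl.
  have := no y1; have := no y2; rewrite G1 G2 /= => /negbT.
  by rewrite negbK => /eqP -> /negbT; rewrite negbK => /eqP ->.
pose ch x y := inner x && ((y == f1 x) || ((x == v) && (y == f2))).
have chP x y : ch x y -> [/\ inner x, G x y & d x < d y].
  case/andP=> inx /orP[/eqP->|/andP[/eqP xv /eqP->]]; have [] := f1P _ inx.
    by split.
  move=> _ _; rewrite {x}xv in inx *; have [Gf2 _] := f2P inx; split=> //.
  by rewrite dv0 dpos // eq_sym (adj_neq Gf2).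
(* The weight that y receives from its parent, 0 or 1. *)
pose inn y := \sum_x ch x y.
have inn1 y : inn y <= 1.
  apply: sum_bool_le1 => x x' /chP[_ G1 d1] /chP[_ G2 d2].
  by apply: (lev y); rewrite 1?adj_sym // ltnW.
have innv : inn v = 0.
  by rewrite /inn big1 // => x _; case h : (ch x v) => //; case/chP: h; rewrite dv0.
have outE x : \sum_y ch x y = inner x * (1 + (x == v)).
  case inx : (inner x); last by rewrite big1 // => y _; rewrite /ch inx.
  rewrite /ch inx /=; have [xv|_] := eqVneq x v; last first.
    by under eq_bigr do rewrite orbF; rewrite -big_mkcond big_pred1_eq.
  rewrite (eq_bigr (fun y => (y == f1 x) + (y == f2))) => [|y _].
    by rewrite big_split /= -!big_mkcond !big_pred1_eq.
  case: eqVneq => [->|//] /=; rewrite xv in inx *; have [_] := f2P inx.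
  by rewrite eq_sym => /negbTE ->.
have inn_leaf s l : G l s -> lf l -> lf s -> inn s = 0.
  move=> Gls /eqP/leafP[t ht] /eqP ls; rewrite /inn big1 // => x _.
  case h : (ch x s) => //; case/chP: h => /andP[_ /forallP/(_ s)] h Gxs _.
  by move: h; rewrite Gxs /lf ls.
(* If both ends are leaves the two branches agree, as neither end receives anything. *)
pose pend x y := if lf x then 2 - inn y else if lf y then 2 - inn x else 0.
pose w x y := ch x y + ch y x + G x y * pend x y.
have Ww : weighting G w.
  split=> x y.
    rewrite /w [ch x y + _]addnC [G x y]adj_sym; congr (_ + _).
    case Gyx : (G y x); rewrite ?mul0n // !mul1n /pend.
    case lx : (lf x); case ly : (lf y) => //.
    by rewrite (inn_leaf y x) ?(inn_leaf x y) // adj_sym.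
  case Gxy : (G x y) => //; rewrite /w Gxy mul0n addn0.
  case h : (ch x y); first by case/chP: h; rewrite Gxy.
  by case h' : (ch y x) => //; case/chP: h'; rewrite adj_sym Gxy.
have degE x : wdeg w x = \sum_y ch x y + inn x + \sum_y G x y * pend x y.
  by rewrite /wdeg /w !big_split.
have deg_leaf x : lf x -> exists2 s, G x s & wdeg w x = 2 - inn s.
  move=> lx; have [s hs] := leafP (eqP lx).
  have Gxs : G x s by rewrite hs.
  exists s => //; rewrite degE outE /inner lx mul0n add0n.
  rewrite (_ : inn x = 0) ?add0n; last first.
    rewrite /inn big1 // => y _; case h : (ch y x) => //.
    by case/chP: h => /andP[_ /forallP/(_ x)] + Gyx _; rewrite lx Gyx.
  rewrite (bigD1 s) //= Gxs mul1n /pend lx big1 ?addn0 // => y ys.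
  by rewrite hs (negbTE ys).
have deg_supp x l : ~~ lf x -> G x l -> lf l -> wdeg w x = 2.
  move=> nlx Gxl ll; rewrite degE outE (_ : inner x = false); last first.
    by apply/negbTE; rewrite /inner nlx /=; apply/forallPn; exists l; rewrite Gxl ll.
  rewrite mul0n add0n (bigD1 l) //= Gxl mul1n /pend (negbTE nlx) ll.
  rewrite big1 ?addn0 ?subnKC //; first by apply: leq_trans (inn1 x) _.
  move=> y yl; case Gxy : (G x y) => //; rewrite mul1n; case: ifP => // ly.
  case/eqP: yl; apply: (@twin y l x); rewrite 1?adj_sym //; exact/eqP.
have deg_inner x : inner x -> wdeg w x = 1 + (x == v) + inn x.
  move=> inx; rewrite degE outE inx mul1n big1 ?addn0 // => y _.
  case/andP: inx => nlx /forallP/(_ y); case: (G x y) => //= nly.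
  by rewrite /pend (negbTE nlx) (negbTE nly).
exists w => //; split.
  move=> x; case lx : (lf x).
    by have [s _ ->] := deg_leaf _ lx; have := inn1 s; lia.
  case inx : (inner x).
    rewrite (deg_inner _ inx); have [->|_] := eqVneq x v; first by rewrite innv.
    by have := inn1 x; lia.
  have /forallPn[l] : ~~ [forall y, G x y ==> ~~ lf y] by move: inx; rewrite /inner lx => /negbT.
  by rewrite negb_imply negbK => /andP[Gxl ll]; rewrite (deg_supp x l) ?lx.
case lx : (lf v).
  have [s Gvs ->] := deg_leaf _ lx; rewrite (_ : inn s = 0) //.
  rewrite /inn big1 // => x _; case h : (ch x s) => //; case/chP: h => inx Gxs dxs.
  have xv : x = v.
    apply: (lev s); rewrite 1?adj_sym //; first exact: ltnW.
    by rewrite dv0.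
  by move: inx; rewrite xv /inner lx.
case inx : (inner v); first by rewrite deg_inner // eqxx innv.
have /forallPn[l] : ~~ [forall y, G v y ==> ~~ lf y] by move: inx; rewrite /inner lx => /negbT.
by rewrite negb_imply negbK => /andP[Gxl ll]; rewrite (deg_supp v l) ?lx.
Qed.

End PathCover.

(** * Bounded powers of edge ideals *)

Module BoundedPowers.
Import mpoly.
Local Open Scope classical_set_scope.
Local Open Scope ring_scope.

Section Ideals.
Context {A : comNzRingType}.
Implicit Types I E : set A.

Lemma ideal_span_ideal E : is_ideal (ideal_span E).
Proof.
split.
- by move=> J [[]].
- by move=> x y Ex Ey J hJ; case: (hJ) => [[_ JD _] _]; apply: JD; [exact: Ex|exact: Ey].
- by move=> a x Ex J hJ; case: (hJ) => [[_ _ JM] _]; apply: JM; exact: Ex.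
Qed.

Lemma ideal_exp_ideal I q : is_ideal (ideal_exp I q).
Proof. by case: q => [|q]; [split | apply: ideal_span_ideal]. Qed.

End Ideals.

Section MonomialIdeals.
Context (K : fieldType) {n : nat}.
Implicit Types (E F U : set 'X_{1..n}) (m u : 'X_{1..n}).

(** When membership in [U] is inherited by multiples, this is the ideal spanned by
    the monomials of [U], described through supports. *)
Definition supported U : set {mpoly K[n]} := [set p | forall m, m \in msupp p -> U m].

Definition above E : set 'X_{1..n} := [set m | exists2 u, E u & (u <= m)%MM].

Lemma supported_ideal E : is_ideal (supported (above E)).
Proof.
split.
- by move=> m; rewrite mcoeff_msupp mcoeff0 eqxx.
- by move=> p q hp hq m /msuppD_le; rewrite mem_cat => /orP[/hp|/hq].
- move=> p q hq m /msuppM_le/allpairsP[[m1 m2] [_ /hq[u Eu um] ->]].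
  by exists u => //; apply: lepm_trans um (lem_addl _ _).
Qed.

Lemma in_supportedX U m : supported U 'X_[m] <-> U m.
Proof.
by split=> [|Um m']; [apply; rewrite msuppX inE | rewrite msuppX inE => /eqP->].
Qed.

Lemma in_ideal_above (I : set {mpoly K[n]}) u m :
  is_ideal I -> I 'X_[u] -> (u <= m)%MM -> I 'X_[m].
Proof. by move=> [_ _ IM] Iu um; rewrite -(submK um) mpolyXD; exact: IM. Qed.

Lemma in_monomial_ideal E m : @monomial_ideal K n E 'X_[m] <-> above E m.
Proof.
split=> [|[u Eu um]].
  rewrite -in_supportedX; apply: smallest_sub; first exact: supported_ideal.
  by move=> _ [u Eu <-]; apply/in_supportedX; exists u => //; exact: lepm_refl.
apply: in_ideal_above um; first exact: ideal_span_ideal.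
by apply: sub_gen_smallest; exists u.
Qed.

Lemma monomial_ideal_sub E F : E `<=` above F -> @monomial_ideal K n E `<=` @monomial_ideal K n F.
Proof.
move=> EF; apply: smallest_sub; first exact: ideal_span_ideal.
by move=> _ [u /EF Fu <-]; apply/in_monomial_ideal.
Qed.

Lemma monomial_ideal_neq0 E : @monomial_ideal K n E <> [set 0] <-> E !=set0.
Proof.
split=> [h|[u Eu] h].
  apply/set0P/eqP => E0; apply: h; apply/seteqP; split.
    apply: smallest_sub; last by move=> p [u]; rewrite E0.
    split=> // [x y -> ->|a x ->] /=; first by rewrite addr0.
    by rewrite mulr0.
  by move=> _ ->; case: (ideal_span_ideal [set 'X_[K, m] | m in E]).
have : @monomial_ideal K n E 'X_[u] by apply/in_monomial_ideal; exists u => //; exact: lepm_refl.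
by rewrite h /= => /eqP; rewrite -msupp_eq0 msuppX.
Qed.

(** A monomial lies in a monomial ideal only if it is a multiple of a generator, so
    each element of the antichain must be one of the chosen generators. *)
Lemma minimal_generators_antichain E :
  (forall u v, E u -> E v -> (u <= v)%MM -> u = v) ->
  minimal_generators (@monomial_ideal K n E) = E.
Proof.
move=> anti; rewrite /minimal_generators; case: xgetP => [B _ [BE Bmin]|no]; last first.
  case: (no E); split=> // B BE eqB; apply/seteqP; split=> // u Eu.
  have : @monomial_ideal K n B 'X_[u].
    by rewrite eqB; apply/in_monomial_ideal; exists u => //; exact: lepm_refl.
  by case/in_monomial_ideal=> v Bv /(anti _ _ (BE _ Bv) Eu) <-.
rewrite [RHS]Bmin // => u Eu.
have : @monomial_ideal K n B 'X_[u].
  by rewrite BE; apply/in_monomial_ideal; exists u => //; exact: lepm_refl.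
case/in_monomial_ideal=> b Bb bu.
have : @monomial_ideal K n E 'X_[b].
  by rewrite -BE; apply/in_monomial_ideal; exists b => //; exact: lepm_refl.
case/in_monomial_ideal=> v Ev vb.
have vu := anti _ _ Ev Eu (lepm_trans vb bu).
suff -> : u = b by [].
apply/mnmP => i; apply/eqP; rewrite eqn_leq (mnm_lepP bu) andbT.
by rewrite -vu; exact: (mnm_lepP vb).
Qed.

End MonomialIdeals.

Section EdgePowers.
Context (K : fieldType) {n : nat} (G : sgraph n).
Implicit Types (m u : 'X_{1..n}) (c : 'I_n -> nat) (q : nat).

(** Each of the [q] edges, counted with multiplicity, adds 2 to the total degree. *)
Definition degree_vectors q : set 'X_{1..n} := [set u |
  mdeg u = q.*2 /\ exists2 w, weighting G w & forall i, u i = wdeg w i].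

Lemma degree_vectors0 : degree_vectors 0 0%MM.
Proof.
split; first by rewrite mdeg0.
exists (fun _ _ => 0%N) => // i.
by rewrite mnm0E /wdeg big1.
Qed.

Lemma degree_vectorsS q i j u :
  G i j -> degree_vectors q u -> degree_vectors q.+1 (U_(i) + U_(j) + u)%MM.
Proof.
move=> Gij [du [w Ww uw]]; split; first by rewrite !mdegD !mdeg1 du doubleS.
exists (fun a b => edge_weight i j a b + w a b)%N.
  have [E1 E2] := edge_weighting Gij; split=> a b; first by rewrite E1 Ww.1.
  by rewrite addn_gt0 => /orP[/E2|/Ww.2].
move=> a; rewrite /wdeg big_split /= -/(wdeg _ a) (wdeg_edge _ (adj_neq Gij)).
by rewrite !mnmDE !mnm1E uw ![a == _]eq_sym.
Qed.

Lemma degree_vectors_inv q u : degree_vectors q.+1 u ->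
  exists i j u', [/\ G i j, degree_vectors q u' & u = (U_(i) + U_(j) + u')%MM].
Proof.
move=> [du [w Ww uw]].
have [i [j wij]] : exists i j, (0 < w i j)%N.
  apply: contrapT => no; suff : mdeg u = 0%N by rewrite du.
  rewrite mdegE big1 // => i _; rewrite uw /wdeg big1 // => j _.
  by apply/eqP; rewrite -leqn0 leqNgt; apply/negP => wij; apply: no; exists i, j.
have Gij := Ww.2 _ _ wij; have nij := adj_neq Gij.
have le1 a b : (edge_weight i j a b <= w a b)%N.
  case: (posnP (edge_weight i j a b)) => [->//|pos].
  apply: leq_trans (edge_weight_le1 i j a b) _.
  by apply: (edge_weightP (P := fun a b => 0 < w a b)%N) pos; rewrite // Ww.1.
have deg a : u a = ((a == i) + (a == j) + wdeg (fun a b => w a b - edge_weight i j a b)%N a)%N.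
  rewrite uw -wdeg_edge // /wdeg -big_split /=; apply: eq_bigr => b _.
  by rewrite subnKC.
pose u' := [multinom wdeg (fun a b => w a b - edge_weight i j a b)%N a | a < n].
have uE : u = (U_(i) + U_(j) + u')%MM.
  by apply/mnmP => a; rewrite deg !mnmDE !mnm1E mnmE ![a == _]eq_sym.
exists i, j, u'; split=> //; split.
  by move: du; rewrite uE !mdegD !mdeg1 doubleS => -[].
exists (fun a b => w a b - edge_weight i j a b)%N => [|a]; last by rewrite mnmE.
have [E1 _] := edge_weighting Gij; split=> a b; first by rewrite E1 Ww.1.
by rewrite subn_gt0 => /(leq_ltn_trans (leq0n _)) /Ww.2.
Qed.

(** A product of [q] edges is the monomial of the degree vector of the weight that
    counts the edges. *)
Lemma in_edge_ideal_exp q m :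
  ideal_exp (@edge_ideal K n G) q 'X_[m] <-> above (degree_vectors q) m.
Proof.
split=> [|[u Du um]]; last first.
  apply: in_ideal_above um; first exact: ideal_exp_ideal.
  elim: q u Du => // q IH u /degree_vectors_inv[i [j [u' [Gij Du' ->]]]].
  apply: sub_gen_smallest; exists ('X_i * 'X_j); last exists 'X_[u']; last by rewrite -!mpolyXD.
    by apply: sub_gen_smallest; exists i, j.
  exact: IH.
rewrite -(in_supportedX K); move: 'X_[_].
elim: q => [|q IH] p.
  move=> _ k _; exists 0%MM; first exact: degree_vectors0.
  by apply/mnm_lepP => i; rewrite mnm0E.
apply: smallest_sub; first exact: supported_ideal.
move=> _ [x Ix [y /IH hy <-]] k /msuppM_le/allpairsP[[k1 k2] /= [k1x /hy[u Du uk] ->]].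
have [i [j [Gij le1]]] : exists i j, G i j /\ (U_(i) + U_(j) <= k1)%MM.
  have : supported (above [set m | exists i j, G i j /\ m = (U_(i) + U_(j))%MM]) x.
    apply: (@smallest_sub _ _ _ (supported _) _ _ _ Ix); first exact: supported_ideal.
    move=> _ [i [j [Gij ->]]]; rewrite -mpolyXD; apply/in_supportedX.
    by exists (U_(i) + U_(j))%MM; [exists i, j | exact: lepm_refl].
  by move=> /(_ _ k1x)[_ [i [j [Gij ->]]] le1]; exists i, j.
exists (U_(i) + U_(j) + u)%MM; first exact: degree_vectorsS.
by apply/mnm_lepP => a; rewrite ![(_ + _)%MM _]mnmDE -mnmDE leq_add //; exact/mnm_lepP.
Qed.

Definition bounded_degree_vectors c q : set 'X_{1..n} :=
  [set u | degree_vectors q u /\ forall i, (u i <= c i)%N].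

Lemma bounded_powerE c q :
  @bounded_power K n G c q = @monomial_ideal K n (bounded_degree_vectors c q).
Proof.
apply/seteqP; split; apply: monomial_ideal_sub.
  move=> m [/in_edge_ideal_exp[u Du um] mc]; exists u => //; split=> // i.
  by apply: leq_trans (mc i); exact/mnm_lepP.
move=> u [Du uc]; exists u; last exact: lepm_refl.
by split=> //; apply/in_edge_ideal_exp; exists u => //; exact: lepm_refl.
Qed.

(** All degree vectors of weights of a given size have the same total degree, so
    they form an antichain. *)
Lemma BsetE c : Bset K G c = bounded_degree_vectors c (delta K G c).
Proof.
rewrite /Bset bounded_powerE; apply: minimal_generators_antichain.
move=> u v [[du _] _] [[dv _] _] uv.
have : mdeg (v - u)%MM = 0%N.
  by move: dv; rewrite -{1}(submK uv) mdegD du => /eqP; rewrite -[X in _ == X]add0n eqn_add2r => /eqP.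
by move/eqP; rewrite mdeg_eq0 => /eqP vu; rewrite -(submK uv) vu add0m.
Qed.

Lemma deltaP c : (forall i, 0 < c i)%N -> (exists i j, G i j) ->
  (bounded_degree_vectors c (delta K G c) !=set0) /\
  (forall q, bounded_degree_vectors c q !=set0 -> q <= delta K G c)%N.
Proof.
move=> cpos [i [j Gij]].
have ne q : @bounded_power K n G c q <> [set 0] <-> bounded_degree_vectors c q !=set0.
  by rewrite bounded_powerE monomial_ideal_neq0.
have bound q : bounded_degree_vectors c q !=set0 -> (q <= \sum_i c i)%N.
  move=> [u [[du _] uc]]; apply: (@leq_trans q.*2); first by rewrite -addnn leq_addr.
  by rewrite -du mdegE leq_sum.
have ne1 : bounded_degree_vectors c 1 !=set0.
  exists (U_(i) + U_(j) + 0)%MM; split.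
    by apply: degree_vectorsS => //; exact: degree_vectors0.
  move=> k; rewrite !mnmDE !mnm1E mnm0E addn0; apply: leq_trans (cpos k).
  by case: eqVneq => [<-|_] //=; [rewrite eq_sym (negbTE (adj_neq Gij)) | case: eqP].
rewrite /delta; case: xgetP => [d _ [[d0 /ne dn] dmax]|no].
  split=> // -[//|q] hq; apply: dmax; split=> //; exact/ne.
have ex : exists q, `[< bounded_degree_vectors c q !=set0 >] by exists 1%N; exact/asboolP.
have ub q : `[< bounded_degree_vectors c q !=set0 >] -> (q <= \sum_i c i)%N by move/asboolP/bound.
case: (ex_maxnP ex ub) => d /asboolP hd dmax.
case: (no d); split; first split; [|exact/ne|].
  by apply: dmax; exact/asboolP.
by move=> r [_ /ne hr]; apply: dmax; exact/asboolP.
Qed.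

(** Each edge is counted twice, once from each end. *)
Lemma weighting_even w : weighting G w -> ~~ odd (\sum_i wdeg w i).
Proof.
move=> Ww; have -> : (\sum_i wdeg w i = (\sum_(i < n) \sum_(j < n | (i < j)%N) w i j).*2)%N.
  rewrite -addnn [X in (_ + X)%N](exchange_big_dep predT) //= -big_split /=.
  apply: eq_bigr => i _; rewrite /wdeg (bigID (fun j : 'I_n => (i < j)%N)) /=.
  congr addn; rewrite big_mkcond [RHS]big_mkcond /=; apply: eq_bigr => j _.
  case: ltngtP => //; first by rewrite Ww.1.
  move=> /ord_inj ->; case: (posnP (w j j)) => // /Ww.2.
  by rewrite adj_irr.
by rewrite odd_double.
Qed.

(** A c-matching need not have maximum size, but the exchange lemma raises it to
    one that does without lowering any degree. *)
Lemma in_Dset c (a : 'X_{1..n}) : (forall i, 0 < c i)%N -> (exists i j, G i j) ->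
  Dset K G c a <-> coverable G c a.
Proof.
move=> cpos Gne; have [[v [[dv [ws Ws vE]] vc]] dmax] := deltaP cpos Gne.
rewrite /Dset BsetE; split=> [[u [[_ [w Ww uw]] uc] au]|[w Ww aw]].
  by exists w => // i; rewrite -uw uc andbT; exact/mnm_lepP.
have [i|i|w' [W' h' s']] := weighting_exchange (c := c) Ww _ Ws.
- by case/andP: (aw i).
- by rewrite -vE.
pose u := [multinom wdeg w' i | i < n].
have uE i : u i = wdeg w' i by rewrite mnmE.
exists u; last first.
  apply/mnm_lepP => i; rewrite uE.
  by have /andP[h1 _] := aw i; have /andP[h2 _] := h' i; exact: leq_trans h1 h2.
have uc i : (u i <= c i)%N by rewrite uE; case/andP: (h' i).
have du : mdeg u = (mdeg u)./2.*2.
  rewrite -[LHS]odd_double_half mdegE (eq_bigr _ (fun i _ => uE i)).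
  by rewrite (negbTE (weighting_even W')).
(* Maximality of the size of v forces u to have the same size. *)
have Du : bounded_degree_vectors c (mdeg u)./2 u.
  by split=> //; split=> //; exists w'.
have : ((mdeg u)./2 <= delta K G c)%N by apply: dmax; exists u.
move: s'; rewrite -(eq_bigr _ (fun i _ => vE i)) -mdegE dv -(eq_bigr _ (fun i _ => uE i)).
rewrite -mdegE {1}du leq_double => h1 h2.
by have <- : (mdeg u)./2 = delta K G c by apply/eqP; rewrite eqn_leq h1 h2.
Qed.

Lemma DpointsE (R : realType) c : (forall i, 0 < c i)%N -> (exists i j, G i j) ->
  Dpoints K G c = [set x : 'rV[R]_n | exists2 a, coverable G c a & x = \row_i (a i)%:R].
Proof.
move=> cpos Gne; apply/seteqP; split=> x => [[a Da <-]|[a [w Ww aw] ->]].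
  by exists a => //; apply/(in_Dset _ cpos Gne).
exists [multinom a i | i < n].
  by apply/(in_Dset _ cpos Gne); exists w => // i; rewrite mnmE.
by apply/rowP => i; rewrite !mxE mnmE.
Qed.

End EdgePowers.
End BoundedPowers.

(** * Leaves at distance two *)

Section Distance.
Local Open Scope nat_scope.
Context {n : nat} (G : sgraph n).

Lemma geq_bigminn (I : eqType) (r : seq I) (P : pred I) (F : I -> nat) m i :
  i \in r -> P i -> \big[minn/m]_(k <- r | P k) F k <= F i.
Proof.
elim: r => // k r IH; rewrite in_cons big_cons => /orP[/eqP <- ->|ir Pi].
  exact: geq_minl.
by case: ifP => _; rewrite ?(leq_trans (geq_minr _ _)) // IH.
Qed.

Lemma bigminn_attained (I : eqType) (r : seq I) (P : pred I) (F : I -> nat) m :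
  \big[minn/m]_(k <- r | P k) F k = m \/
  exists2 i, P i & \big[minn/m]_(k <- r | P k) F k = F i.
Proof.
elim: r => [|k r IH]; first by left; rewrite big_nil.
rewrite big_cons; case: ifP => // Pk; rewrite /minn; case: ifP => // _.
by right; exists k.
Qed.

Definition path_length x y k :=
  exists2 p : k.-tuple 'I_n, path G x p & last x p = y /\ uniq (x :: p).

Lemma dist_le x y k : k < n -> path_length x y k -> dist G x y <= k.
Proof.
move=> kn [p pp [pl pu]]; rewrite /dist.
apply: (@geq_bigminn _ _ _ (fun k : 'I_n => val k) _ (Ordinal kn)).
  by rewrite mem_index_enum.
by apply/existsP; exists p; rewrite pp pl pu eqxx.
Qed.

Lemma dist_attained x y : dist G x y < n -> path_length x y (dist G x y).
Proof.
rewrite /dist => lt; case: (@bigminn_attained _ (index_enum 'I_n) (fun k : 'I_n =>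
    [exists p : k.-tuple 'I_n, [&& path G x p, last x p == y & uniq (x :: p)]])
    (fun k => val k) n).
  by move=> e; rewrite e ltnn in lt.
by move=> [k /existsP[p /and3P[pp /eqP pl pu]] ->]; exists p.
Qed.

Lemma dist_lt x y : connected G -> dist G x y < n.
Proof.
move=> /(_ x y)/connectP[p0 pp0]; case/shortenP: pp0 => p pp pu _ ->.
have pn : size p < n.
  by move/card_uniqP: pu => /= <-; rewrite -[leqRHS]card_ord max_card.
by apply: leq_ltn_trans (dist_le pn _) pn; exists (in_tuple p).
Qed.

Lemma leaf_nbr_eq x y z : leaf G x -> G x y -> G x z -> y = z.
Proof. by move=> /leafP[s hs]; rewrite !hs => /eqP-> /eqP->. Qed.

Lemma dist_twin_leaves : connected G ->
  (forall x1 x2, leaf G x1 -> leaf G x2 -> dist G x1 x2 <> 2) <-> no_twin_leaves G.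
Proof.
move=> conn; split=> [far x1 x2 y l1 l2 G1 G2|twin x1 x2 l1 l2 d2].
  apply/eqP/contraT => n12; case: (far _ _ l1 l2); apply/eqP.
  have u : uniq [:: x1; y; x2].
    by rewrite /= !inE negb_or n12 (adj_neq G1) eq_sym (adj_neq G2).
  have n3 : 2 < n by move/card_uniqP: u => /= <-; rewrite -[leqRHS]card_ord max_card.
  have le2 : dist G x1 x2 <= 2.
    by apply: dist_le => //; exists [tuple y; x2] => //=; rewrite G1 adj_sym G2.
  rewrite eqn_leq le2 leqNgt ltnS leq_eqVlt ltnS leqn0; apply/negP => d01.
  have := dist_attained (dist_lt x1 x2 conn).
  case/orP: d01 => /eqP ->; case.
    case/tupleP=> a p; rewrite (tuple0 p) /= andbT => Ga [ax _].
    have yx : y = x2 by rewrite -ax; apply: leaf_nbr_eq G1 Ga.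
    by rewrite yx adj_irr in G2.
  by move=> p _ []; rewrite (tuple0 p) /= => e; rewrite e eqxx in n12.
have := dist_attained (dist_lt x1 x2 conn); rewrite d2 => -[].
case/tupleP=> a p; case/tupleP: p => b p; rewrite (tuple0 p) /= andbT.
move=> /andP[G1 Gab] [bx]; rewrite !inE !negb_or => /andP[/andP[_ /eqP n12] _].
by apply: n12; apply: (twin _ _ a); rewrite // ?bx // -bx adj_sym.
Qed.

End Distance.

(** * Convex hulls and interiors *)

Module CoverablePolytopes.
Import topology convex Polytopes.
Import numFieldTopology.Exports.
Local Open Scope classical_set_scope.
Local Open Scope ring_scope.

Section ConvexHulls.
Context {R : realType} {n : nat}.
Implicit Types (E A P : set 'rV[R]_n) (x y z p : 'rV[R]_n) (i j : 'I_n).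

Lemma convex_setP A : @convex_set R 'rV[R]_n A <->
  (forall x y (t : R), 0 <= t <= 1 -> A x -> A y -> A (t *: x + (1 - t) *: y)).
Proof.
split=> [cA x y t /andP[t0 t1] /mem_set Ax /mem_set Ay|cA x y t].
  exact: (set_mem (cA x y (Itv01 t0 t1) Ax Ay)).
by move=> /set_mem Ax /set_mem Ay; apply/mem_set/cA => //; apply/andP; split.
Qed.

Lemma conv_convex E x y (t : R) :
  0 <= t <= 1 -> conv E x -> conv E y -> conv E (t *: x + (1 - t) *: y).
Proof.
move=> t01 Ex Ey A hA; case: (hA) => /convex_setP cA _; apply: cA => //.
  exact: Ex.
exact: Ey.
Qed.

Lemma conv_min E A :
  (forall x y (t : R), 0 <= t <= 1 -> A x -> A y -> A (t *: x + (1 - t) *: y)) ->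
  E `<=` A -> conv E `<=` A.
Proof. by move=> /convex_setP; exact: smallest_sub. Qed.

(** Removing an extreme point from a convex set leaves it convex, so a vertex
    outside [E] could be removed from the hull of [E]. *)
Lemma vertex_conv E v : vertex (conv E) v -> E v.
Proof.
move=> [Ev ext]; apply: contrapT => nEv.
suff /(_ v Ev)[_] : conv E `<=` conv E `\ v by apply.
apply: conv_min => [x y t t01 [Ex xv] [Ey yv]|x Ex]; last first.
  by split; [exact: sub_gen_smallest | move=> /= xv; apply: nEv; rewrite -xv].
split; first exact: conv_convex.
move=> /= /esym h; case/andP: t01; rewrite !le_eqVlt => /orP[/eqP t0|t0].
  by case: yv; rewrite h -t0 scale0r add0r subr0 scale1r.
move=> /orP[/eqP t1|t1]; first by case: xv; rewrite h t1 scale1r subrr scale0r addr0.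
by have [|/xv] := ext x y t Ex Ey _ h; rewrite ?t0.
Qed.

Lemma conv_image E (f : {linear 'rV[R]_n -> 'rV[R]_n}) x :
  (forall y, E y -> conv E (f y)) -> conv E x -> conv E (f x).
Proof.
move=> Ef; move: x; apply: (@conv_min E (f @^-1` conv E)) => // x y t t01 Ex Ey /=.
by rewrite linearD !linearZ; exact: conv_convex.
Qed.

Lemma conv_mean E N (f : 'I_N.+1 -> 'rV[R]_n) :
  (forall k, conv E (f k)) -> conv E (N.+1%:R^-1 *: \sum_k f k).
Proof.
elim: N f => [|N IH] f Ef.
  by rewrite big_ord_recl big_ord0 addr0 invr1 scale1r.
have N1 : N.+1%:R != 0 :> R by rewrite pnatr_eq0.
have N2 : N.+2%:R != 0 :> R by rewrite pnatr_eq0.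
pose t : R := N.+2%:R^-1.
rewrite big_ord_recl scalerDr.
have -> : N.+2%:R^-1 *: \sum_(i < N.+1) f (lift ord0 i) =
          (1 - t) *: (N.+1%:R^-1 *: \sum_(i < N.+1) f (lift ord0 i)).
  rewrite scalerA; congr (_ *: _).
  apply: (mulfI N2); rewrite mulfV // mulrA mulrBr mulr1 mulfV //.
  by rewrite -natr1 addrK mulfV.
apply: conv_convex => //; last exact: IH.
by rewrite invr_ge0 ler0n invf_le1 ?ltr0n // ler1n.
Qed.

Definition drop_coord i x : 'rV[R]_n := \row_j (if j == i then 0 else x ord0 j).

Lemma drop_coord_linear i : linear (drop_coord i).
Proof.
by move=> a x y; apply/rowP => j; rewrite !mxE; case: eqP; rewrite // mulr0 addr0.
Qed.

HB.instance Definition _ i :=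
  GRing.isLinear.Build R 'rV[R]_n 'rV[R]_n *:%R (drop_coord i) (drop_coord_linear i).

(** Decreasing one coordinate of a point is moving towards its image under
    [drop_coord], which stays in the hull; the coordinates are treated one after
    the other. *)
Lemma conv_down E x y : (forall i z, E z -> E (drop_coord i z)) ->
  conv E x -> (forall j, 0 <= y ord0 j <= x ord0 j) -> conv E y.
Proof.
move=> dropE Ex yx.
have step (s : seq 'I_n) : conv E (\row_j (if j \in s then y ord0 j else x ord0 j)).
  elim: s => [|i s IH].
    by rewrite (_ : \row_j _ = x) //; apply/rowP => j; rewrite !mxE.
  set z := (\row_j _ : 'rV[R]_n) in IH.
  have [is_|nis] := boolP (i \in s).
    rewrite (_ : \row_j _ = z) //; apply/rowP => j; rewrite !mxE in_cons.
    by case: eqP => // ->; rewrite is_.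
  have /andP[y0 yxi] := yx i.
  (* If x vanishes at i then so does y, and the quotient is 0. *)
  have tE : y ord0 i / x ord0 i * x ord0 i = y ord0 i.
    have [x0|x0] := eqVneq (x ord0 i) 0; last by rewrite divfK.
    by rewrite x0 in yxi *; rewrite mulr0; apply/eqP; rewrite eq_le y0 yxi.
  have t01 : 0 <= y ord0 i / x ord0 i <= 1.
    rewrite divr_ge0 ?(le_trans y0) //=.
    have [x0|x0] := eqVneq (x ord0 i) 0; first by rewrite x0 invr0 mulr0.
    by rewrite ler_pdivrMr ?mul1r // lt_def x0 (le_trans y0).
  rewrite (_ : \row_j _ = (y ord0 i / x ord0 i) *: z +
      (1 - y ord0 i / x ord0 i) *: drop_coord i z).
    apply: conv_convex => //. apply: (@conv_image _ (drop_coord i)) => // w Ew.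
    by apply: sub_gen_smallest; exact: dropE.
  apply/rowP => j; rewrite !mxE in_cons; case: (eqVneq j i) => [->|_] /=.
    by rewrite (negbTE nis) mulr0 addr0 tE.
  by rewrite -mulrDl addrCA subrr addr0 mul1r.
rewrite (_ : y = \row_j (if j \in enum 'I_n then y ord0 j else x ord0 j)) //.
by apply/rowP => j; rewrite mxE mem_enum.
Qed.

Lemma interior_box P p z : (forall y, (forall j, 0 <= y ord0 j <= z ord0 j) -> P y) ->
  (forall j, 0 < p ord0 j < z ord0 j) -> interior P p.
Proof.
move=> box pz; exists (fun _ j => [set r | 0 < r < z ord0 j]).
  move=> i j; rewrite (ord1 i) /=.
  have /andP[p0 pzj] := pz j.
  apply/nbhs_ballP; exists (Num.min (p ord0 j) (z ord0 j - p ord0 j)) => /=.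
    by rewrite lt_min p0 subr_gt0.
  move=> r; rewrite /ball /= lt_min !ltr_norml => /andP[/andP[h1 h2] /andP[h3 h4]].
  by apply/andP; split; lra.
by move=> y yz; apply: box => j; have /andP[/ltW-> /ltW->] := yz ord0 j.
Qed.

Lemma interior_shift P p : interior P p ->
  exists2 e : R, 0 < e & P (p + const_mx e) /\ P (p - const_mx e).
Proof.
move=> /nbhs_ballP[e /= e0 be]; exists (e / 2); first by rewrite divr_gt0.
have h (s : R) : `|s| < e -> P (p + const_mx s).
  move=> se; apply: be; split=> // i j.
  rewrite !mxE /ball /= opprD addrA subrr add0r normrN //.
split; last rewrite (_ : - const_mx _ = const_mx (- (e / 2))).
- by apply: h; rewrite gtr0_norm ?divr_gt0 // ltr_pdivrMr // ltr_pMr // ltr1n.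
- by apply: h; rewrite normrN gtr0_norm ?divr_gt0 // ltr_pdivrMr // ltr_pMr // ltr1n.
- by apply/rowP => j; rewrite !mxE.
Qed.

Lemma off_boundary P : P `\` boundary P = interior P.
Proof.
apply/seteqP; split=> x.
  by move=> [Px nb]; apply: contrapT => ni; apply: nb; split=> //; exact: subset_closure.
by move=> ix; split; [exact: interior_subset | case].
Qed.

End ConvexHulls.

(** * The polytope of coverable vectors *)

Section CoverablePolytope.
Context (R : realType) {n : nat} (G : sgraph n).
Implicit Types (c a : 'I_n -> nat) (x y : 'rV[R]_n).

Definition coverable_points c : set 'rV[R]_n :=
  [set x | exists2 a, coverable G c a & x = \row_i (a i)%:R].

Lemma coverable_drop c i x :
  coverable_points c x -> coverable_points c (drop_coord i x).
Proof.
move=> [a [w Ww aw] ->]; exists (fun j => if j == i then 0%N else a j).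
  by exists w => // j; case: eqP => _ //; case/andP: (aw j).
by apply/rowP => j; rewrite !mxE; case: eqP.
Qed.

Lemma coverable_down c x y : conv (coverable_points c) x ->
  (forall j, 0 <= y ord0 j <= x ord0 j) -> conv (coverable_points c) y.
Proof. by apply: conv_down => i z; exact: coverable_drop. Qed.

(** Fractional c-matchings form a convex set, so every point of the hull lies below
    the degrees of one. *)
Lemma conv_coverable_weights c x : conv (coverable_points c) x ->
  exists W : 'I_n -> 'I_n -> R, [/\ forall i j, W i j = W j i,
    forall i j, 0 <= W i j, forall i j, W i j != 0 -> G i j &
    forall i, 0 <= x ord0 i <= \sum_j W i j /\ \sum_j W i j <= (c i)%:R].
Proof.
move: x; apply: conv_min.
  move=> x y t /andP[t0 t1] [V [Vs V0 Vg Vx]] [W [Ws W0 Wg Wy]].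
  have t1' : 0 <= 1 - t by rewrite subr_ge0.
  exists (fun i j => t * V i j + (1 - t) * W i j); split.
  - by move=> i j; rewrite Vs Ws.
  - by move=> i j; rewrite addr_ge0 ?mulr_ge0.
  - move=> i j; apply: contraNT => nG.
    have [V0' W0'] : V i j = 0 /\ W i j = 0.
      by split; apply/eqP; apply: contraNT nG; [exact: Vg|exact: Wg].
    by rewrite V0' W0' !mulr0 addr0.
  - move=> i; rewrite big_split -!mulr_sumr !mxE.
    have [/andP[x0 xV] Vc] := Vx i; have [/andP[y0 yW] Wc] := Wy i.
    split; last first.
      rewrite (le_trans (lerD (ler_wpM2l t0 Vc) (ler_wpM2l t1' Wc))) //.
      by rewrite -mulrDl addrC subrK mul1r.
    apply/andP; split; first by rewrite addr_ge0 ?mulr_ge0.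
    exact: lerD (ler_wpM2l t0 xV) (ler_wpM2l t1' yW).
move=> _ [a [w Ww aw] ->]; exists (fun i j => (w i j)%:R); split.
- by move=> i j; rewrite Ww.1.
- by [].
- by move=> i j; rewrite pnatr_eq0 -lt0n; exact: Ww.2.
- by move=> i; rewrite mxE ler0n /= -natr_sum !ler_nat; apply/andP; exact: aw.
Qed.

Lemma coverable_finite c : finite_set (coverable_points c).
Proof.
pose M := (\max_i c i)%N.
pose g (f : {ffun 'I_n -> 'I_M.+1}) : 'rV[R]_n := \row_i (f i : nat)%:R.
apply: (@sub_finite_set _ _ (g @` setT)); last exact/finite_image/finite_finset.
move=> _ [a [w _ aw] ->]; exists [ffun i => inord (a i)] => //.
apply/rowP => i; rewrite !mxE ffunE inordK // ltnS.
have /andP[h1 h2] := aw i; apply: leq_trans h1 (leq_trans h2 _).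
exact: leq_bigmax.
Qed.

Lemma coverable_lattice c x : coverable_points c x -> lattice x.
Proof. by move=> [a _ ->] i; rewrite mxE; exact: rpred_nat. Qed.

Lemma coverable_unit c i : (forall k, 0 < c k)%N -> (exists j, G i j) ->
  coverable_points c (delta_mx ord0 i).
Proof.
move=> cpos [j Gij]; exists (fun k => k == i : nat).
  exists (edge_weight i j); first exact: edge_weighting.
  move=> k; rewrite wdeg_edge ?(adj_neq Gij) // leq_addr /=.
  apply: leq_trans (cpos k); case: eqVneq => [->|_]; last by case: eqP.
  by rewrite (negbTE (adj_neq Gij)).
by apply/rowP => k; rewrite !mxE eqxx.
Qed.

Lemma nat_squeeze (p q r : nat) (s : R) :
  p%:R <= s -> s <= r%:R -> `|q%:R - s| < 1 -> (p <= q <= r)%N.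
Proof.
rewrite ltr_norml -[(p <= q)%N]ltnS -[(q <= r)%N]ltnS -!(ltr_nat R) -!natr1.
move: p%:R q%:R r%:R => x y z xs sz /andP[h1 h2].
by apply/andP; split; lra.
Qed.

(** A lattice point of the [N]-fold dilation lies below the degrees of a real weight
    bounded by [N * c]; rounding that weight preserves these integral bounds, and
    the resulting weight splits into [N] c-matchings. *)
Lemma coverable_polytope_normal c d : levelling G d -> (forall k, 0 < c k)%N ->
  (forall i, exists j, G i j) -> normal_polytope (conv (coverable_points c)).
Proof.
move=> lev cpos nbr; split.
- split; first by exists (coverable_points c) => //; exact: coverable_finite.
  by move=> x /vertex_conv/coverable_lattice.
- apply/seteqP; split=> // x _.
  pose p (k : 'I_n.+1) : 'rV[R]_n := if unlift ord0 k is Some i then delta_mx ord0 i else 0.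
  pose t (k : 'I_n.+1) := if unlift ord0 k is Some i then x ord0 i else 1 - \sum_i x ord0 i.
  exists n.+1, p, t; split.
  + move=> k; apply: sub_gen_smallest; rewrite /p; case: (unlift ord0 k) => [i|].
      exact: coverable_unit.
    exists (fun=> 0%N); last by apply/rowP => i; rewrite !mxE.
    by exists (fun _ _ => 0%N) => // i; rewrite /wdeg big1.
  + rewrite big_ord_recl /t unlift_none [X in _ + X](eq_bigr (fun i => x ord0 i)) ?subrK //.
    by move=> i _; rewrite liftK.
  + rewrite big_ord_recl /t /p unlift_none scaler0 add0r.
    by rewrite {1}(row_sum_delta x); apply: eq_bigr => i _; rewrite liftK.
move=> N N2 b [[x Dx <-] latt].
have [W [Ws W0 Wg Wx]] := conv_coverable_weights Dx.
have N0 : 0 < N%:R :> R by rewrite ltr0n; case: (N) N2.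
have [|i j|i j|w [Ww _ degw]] := @forest_rounding_nat _ G R d (fun i j => N%:R * W i j) lev.
- by move=> i j; rewrite Ws.
- by rewrite mulr_ge0 // ler0n.
- by rewrite mulf_eq0 negb_or => /andP[_]; exact: Wg.
pose a i := `|Num.floor (N%:R * x ord0 i)|%N.
have aE i : (a i)%:R = N%:R * x ord0 i.
  have := latt i; rewrite mxE => lt.
  have x0 : 0 <= N%:R * x ord0 i.
    by rewrite mulr_ge0 ?ler0n //; have [/andP[]] := Wx i.
  by rewrite /a natr_absz ger0_norm ?floor_ge0 // floorK.
have [i|f fc fa] := coverable_decomposition (c := c) (N := N) (a := a) lev Ww.
  have [/andP[_ xW] Wc] := Wx i.
  apply: (@nat_squeeze _ _ _ (N%:R * \sum_j W i j)).
  - by rewrite aE ler_wpM2l // ltW.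
  - by rewrite natrM ler_wpM2l // ltW.
  - by rewrite mulr_sumr; exact: degw.
exists (fun k => \row_i (f k i)%:R) => [k|].
  have Dk : coverable_points c (\row_i (f k i)%:R) by exists (f k).
  by split; [exact: sub_gen_smallest | exact: coverable_lattice Dk].
apply/rowP => i; rewrite mxE -aE fa natr_sum summxE.
by apply: eq_bigr => k _; rewrite mxE.
Qed.

Lemma interior_coverable_bounds c p j : interior (conv (coverable_points c)) p ->
  0 < p ord0 j < (c j)%:R.
Proof.
move=> /interior_shift[e e0 [/conv_coverable_weights[W [_ _ _ Wp]]
  /conv_coverable_weights[V [_ _ _ Vp]]]].
have [/andP[_ le1] le2] := Wp j; have [/andP[ge0 _] _] := Vp j.
move: (le_trans le1 le2) ge0; rewrite !mxE; move: (p ord0 j) => r h1 h2.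
by apply/andP; split; lra.
Qed.

Lemma lattice_ge1 (p : 'rV[R]_n) j : lattice p -> 0 < p ord0 j -> 1 <= p ord0 j.
Proof.
by move=> /(_ j)/intrP[m ->]; rewrite ltr0z ler1z.
Qed.

Definition twin_sum (x1 x2 y : 'I_n) x : 'rV[R]_n :=
  \row_j (if j == y then x ord0 x1 + x ord0 x2 else x ord0 j).

Lemma twin_sum_linear (x1 x2 y : 'I_n) : linear (twin_sum x1 x2 y).
Proof.
move=> a u v; apply/rowP => j; rewrite !mxE; case: eqP => // _.
by rewrite mulrDr addrACA.
Qed.

HB.instance Definition _ (x1 x2 y : 'I_n) :=
  GRing.isLinear.Build R 'rV[R]_n 'rV[R]_n *:%R (twin_sum x1 x2 y) (twin_sum_linear x1 x2 y).

Lemma leaf_wdeg w (x y : 'I_n) : weighting G w -> leaf G x -> G x y -> wdeg w x = w x y.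
Proof.
move=> Ww lx Gxy; rewrite /wdeg (bigD1 y) //= big1 ?addn0 // => j jy.
apply/eqP; rewrite -leqn0 leqNgt; apply: contra jy => /Ww.2 Gxj.
by apply/eqP/(leaf_nbr_eq lx).
Qed.

(** The edges from [y] to the leaves [x1] and [x2] carry their whole degrees, so
    the degree of [y] is at least the sum of these. *)
Lemma coverable_twin_sum c (x1 x2 y : 'I_n) x : leaf G x1 -> leaf G x2 -> x1 != x2 ->
  G x1 y -> G x2 y -> coverable_points c x -> coverable_points c (twin_sum x1 x2 y x).
Proof.
move=> l1 l2 n12 G1 G2 [a [w Ww aw] ->].
exists (fun j => if j == y then (a x1 + a x2)%N else a j); last first.
  by apply/rowP => j; rewrite !mxE; case: eqP => // _; rewrite natrD.
exists w => // j; case: eqP => // ->; have /andP[_ ->] := aw y; rewrite andbT.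
apply: (@leq_trans (wdeg w x1 + wdeg w x2)).
  by apply: leq_add; [case/andP: (aw x1) | case/andP: (aw x2)].
rewrite (leaf_wdeg Ww l1 G1) (leaf_wdeg Ww l2 G2) [w x1 y]Ww.1 [w x2 y]Ww.1.
rewrite /wdeg (bigD1 x1) //= (bigD1 x2) /=; last by rewrite eq_sym.
by rewrite addnA leq_addr.
Qed.

(** The coordinate of [p] at [y] can be lowered to 1, and it can be set to
    [p x1 + p x2], which is at least 2. *)
Lemma twin_leaves_interior c (x1 x2 y : 'I_n) p : leaf G x1 -> leaf G x2 -> x1 != x2 ->
    G x1 y -> G x2 y -> interior (conv (coverable_points c)) p -> lattice p ->
  exists q1 q2, [/\ q1 != q2, lattice q1 /\ interior (conv (coverable_points c)) q1 &
    lattice q2 /\ interior (conv (coverable_points c)) q2].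
Proof.
move=> l1 l2 n12 G1 G2 ip latp.
have p1 j : 1 <= p ord0 j.
  by apply: lattice_ge1 => //; case/andP: (interior_coverable_bounds j ip).
have [e e0 [Pe _]] := interior_shift ip.
exists (\row_j (if j == y then 1 else p ord0 j)), (twin_sum x1 x2 y p); split.
- apply/eqP => /rowP/(_ y); rewrite !mxE eqxx; have := p1 x1; have := p1 x2.
  by move: (p _ x1) (p _ x2) => r s; lra.
- split; first by move=> j; rewrite mxE; case: eqP.
  apply: (@interior_box _ _ _ _ (p + const_mx e)); first by move=> u; exact: coverable_down.
  move=> j; rewrite !mxE; have := p1 j; case: eqP => _;
    move: (p _ _) => r h; apply/andP; split; lra.
- split; first by move=> j; rewrite mxE; case: eqP => // _; exact: rpredD.
  apply: (@interior_box _ _ _ _ (twin_sum x1 x2 y (p + const_mx e))).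
    move=> u; apply: coverable_down; apply: (@conv_image _ _ _ (twin_sum x1 x2 y)) => // v Dv.
    by apply: sub_gen_smallest; exact: coverable_twin_sum.
  move=> j; rewrite !mxE; have := p1 j; have := p1 x1; have := p1 x2.
  by case: eqP => _; move: (p _ _) (p _ _) (p _ _) => r s t ? ? ?; apply/andP; split; lra.
Qed.

(** Interior lattice points have coordinates strictly between 0 and 2.  Conversely
    the mean over all [v] of the degree vectors given by [path_cover] is at least
    [1 + 1 / n] in every coordinate. *)
Lemma interior_two_points : (1 < n)%N -> is_tree G -> no_twin_leaves G ->
  interior (conv (coverable_points (fun=> 2%N))) `&` @lattice R n = [set const_mx 1].
Proof.
move=> n1 tree twin; apply/seteqP; split=> p.
  move=> [ip latp]; apply/rowP => j; rewrite mxE.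
  have /andP[h0 h2] := interior_coverable_bounds j ip.
  have /intrP[m hm] := latp j; rewrite hm in h0 h2 *.
  move: h0 h2; rewrite ltr0z -[2%:R]/(2%:~R) ltr_int => h0 h2.
  by have -> : m = 1 by lia.
move=> ->; split; last by move=> j; rewrite mxE.
have cover v := path_cover v n1 tree twin.
have /choice[W Wv] : forall v, exists w, weighting G w /\
    ((forall i, 1 <= wdeg w i <= 2)%N /\ wdeg w v = 2%N).
  by move=> v; have [w Ww hw] := cover v; exists w.
have n0 : n.-1.+1 = n by rewrite prednK // ltnW.
pose f (k : 'I_n.-1.+1) : 'rV[R]_n := \row_i (wdeg (W (cast_ord n0 k)) i)%:R.
apply: (@interior_box _ _ _ _ (n.-1.+1%:R^-1 *: \sum_k f k)).
  move=> u; apply: coverable_down; apply: conv_mean => k; apply: sub_gen_smallest.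
  have [Ww [deg _]] := Wv (cast_ord n0 k).
  exists (wdeg (W (cast_ord n0 k))) => //.
  by exists (W (cast_ord n0 k)) => // i; rewrite leqnn; case/andP: (deg i).
move=> j; rewrite !mxE ltr01 /= summxE ltr_pdivlMl ?ltr0n // mulr1.
under eq_bigr do rewrite mxE.
rewrite -natr_sum ltr_nat -[ltnLHS]muln1 -[X in (X * _ < _)%N]card_ord -sum_nat_const.
apply: (@ltn_sum_strict _ _ _ (cast_ord (esym n0) j)) => [k|].
  by have [_ [deg _]] := Wv (cast_ord n0 k); case/andP: (deg j).
by rewrite cast_ordKV; have [_ [_ ->]] := Wv j.
Qed.

End CoverablePolytope.
End CoverablePolytopes.

(** * The characterization *)

Import BoundedPowers CoverablePolytopes.

Theorem theorem4p3 (R : realType) (K : fieldType) (n : nat) (hn : (2 <= n)%N)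
    (T : sgraph n) (hT : is_tree T) :
  labeling_pseudo_gorenstein_star R K T <->
  (forall x1 x2 : 'I_n, leaf T x1 -> leaf T x2 -> dist T x1 x2 <> 2%N).
Proof.
have nbr := no_isolated hn hT.1.
have edge : exists i j, T i j.
  by have [j Tij] := nbr (Ordinal hn); exists (Ordinal hn), j.
rewrite (dist_twin_leaves hT.1); split.
  move=> [c [cpos [_]]]; rewrite off_boundary (DpointsE K R cpos edge).
  set I := (_ `&` _)%classic => /card_set_bijP[g [gI ginj gsurj]] x1 x2 y l1 l2 G1 G2.
  apply/eqP/contraT => n12.
  have [p [ip latp] _] : exists2 p, I p & g p = 0%N by exact: gsurj.
  have [q1 [q2 [/eqP q12 [lat1 i1] [lat2 i2]]]] := twin_leaves_interior l1 l2 n12 G1 G2 ip latp.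
  have g0 q : I q -> g q = 0%N by move=> /gI /=; case: (g q).
  case: q12; apply: ginj; rewrite ?inE //.
  by rewrite !g0.
move=> twin; exists (fun=> 2%N); split=> //.
rewrite (DpointsE K R _ edge) //.
have [d [lev _ _]] := tree_levelling (Ordinal hn) hT.
split; first exact: coverable_polytope_normal lev _ _.
rewrite off_boundary interior_two_points //.
exact: card_set1.
Qed.
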